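(* Let $n, d, m \in \mathbb{N}$ satisfy $n \ge 5$ and $d \ge 2+\left(\frac{12+4\log n}{\pi}\right)^2$. Let $A = A^{(n)} \in \{0,1\}^{n\times n}$ be the lower-triangular all-ones matrix ($A_{i,j}=1$ iff $i \ge j$). Then there exist lower-triangular Toeplitz matrices $B, C \in \mathbb{R}^{n \times n}$ with $A = BC$ and the following properties. (Near-optimality) Let $f(x) = 1/\sqrt{1-x}$ and $B^* = C^* = M(f,n)$. Then $$\|B\|_{2\to\infty} \le \|B^*\|_{2\to\infty} + 16\sqrt{n}\,\exp\!\left(-\tfrac{\pi}{2}\sqrt{d-2}\right), \qquad \|C\|_{1\to 2} \le \|C^*\|_{1\to 2} + 16\sqrt{n}\,\exp\!\left(-\tfrac{\pi}{2}\sqrt{d-2}\right).$$ (Efficiency) There is a streaming algorithm that takes as input a stream of row vectors $Z_{1,\cdot}, Z_{2,\cdot}, \dots, Z_{n,\cdot} \in \mathbb{R}^{1\times m}$ and outputs a stream of row vectors $\widehat Z_{1,\cdot}, \dots, \widehat Z_{n,\cdot} \in \mathbb{R}^{1\times m}$ such that $\widehat Z = C^{-1} Z$ (where $Z,\widehat Z \in \mathbb{R}^{n\times m}$ have these rows), and the space used and the time per iteration of the algorithm are $O(dm)$.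
   Context: $\log$ is the natural logarithm. For a matrix $B$, $\|B\|_{2\to\infty} = \max_i \sqrt{\sum_j B_{i,j}^2}$ (maximum row $\ell_2$ norm) and $\|C\|_{1\to 2} = \max_j \sqrt{\sum_i C_{i,j}^2}$ (maximum column $\ell_2$ norm). Indices of $n\times n$ matrices run over $\{0,\dots,n-1\}$. For a function $g$ analytic near $0$ with Taylor series $g(x) = \sum_{k\ge 0} g_k x^k$, $M(g,n) \in \mathbb{R}^{n\times n}$ is the lower-triangular Toeplitz matrix with $M(g,n)_{i,j} = g_{i-j}$ if $i \ge j$ and $0$ otherwise. A matrix $C$ is lower-triangular Toeplitz if $C_{i,j}=0$ for $i<j$ and $C_{i,j} = c_{i-j}$ for $i \ge j$ for some sequence $c$. Streaming model: at iteration $k$ the algorithm receives the $k$-th input row and must output the $k$-th output row before receiving the next input; each real number occupies one unit of memory and real arithmetic operations take unit time. *)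

(* Defs.v *)
From HB Require Import structures.
From mathcomp Require Import all_boot all_order all_algebra.
From mathcomp Require Import all_classical all_reals all_analysis.

Set Implicit Arguments.
Unset Strict Implicit.
Unset Printing Implicit Defensive.

Import Order.TTheory GRing.Theory Num.Theory.
Import numFieldNormedType.Exports.

Local Open Scope ring_scope.

Definition ones_lt (R : realType) (n : nat) : 'M[R]_n :=
  \matrix_(i, j) (j <= i)%N%:R.

Definition is_lt_toeplitz (R : realType) (n : nat) (C : 'M[R]_n) : Prop :=
  exists c : nat -> R,
    forall i j : 'I_n, C i j = if (j <= i)%N then c (i - j)%N else 0.

(* The default value 0 of the two maxima below is harmless: all the terms are
   nonnegative. *)
Definition norm_2_infty (R : realType) (n : nat) (B : 'M[R]_n) : R :=
  \big[Num.max/0]_(i < n) Num.sqrt (\sum_(j < n) B i j ^+ 2).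

Definition norm_1_2 (R : realType) (n : nat) (C : 'M[R]_n) : R :=
  \big[Num.max/0]_(j < n) Num.sqrt (\sum_(i < n) C i j ^+ 2).

Definition taylor_coef (R : realType) (g : R -> R) (k : nat) : R :=
  derive1n k g 0 / k`!%:R.

(* M(g, n); meaningful for g analytic near 0. *)
Definition toeplitz_of (R : realType) (g : R -> R) (n : nat) : 'M[R]_n :=
  \matrix_(i, j) if (j <= i)%N then taylor_coef g (i - j) else 0.

Definition inv_sqrt_1m (R : realType) (x : R) : R := 1 / Num.sqrt (1 - x).

(* A real RAM with N memory cells, each holding one real number. Every
   instruction takes unit time. *)
Inductive arith := Add | Sub | Mul | Div.

Inductive instr (N : nat) :=
  | Move (x y : 'I_N)                (* x := y *)
  | Op (o : arith) (x y z : 'I_N)    (* x := y o z *)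
  | ReadAt (x y : 'I_N)              (* x := the cell whose address is in y *)
  | WriteAt (x y : 'I_N)             (* the cell whose address is in x := y *)
  | JumpLe (x y : 'I_N) (l : nat).   (* if x <= y then goto l *)

Definition eval_arith (R : realType) (o : arith) (a b : R) : R :=
  match o with
  | Add => a + b
  | Sub => a - b
  | Mul => a * b
  | Div => a / b
  end.

Definition set_cell (R : realType) (N : nat) (mu : 'rV[R]_N) (x : 'I_N) (a : R)
    : 'rV[R]_N :=
  \row_k if k == x then a else mu 0 k.

(* The cell designated by the real number a, if a is a valid address. *)
Definition address (R : realType) (N : nat) (a : R) : option 'I_N :=
  [pick k : 'I_N | a == (k : nat)%:R].

(* A configuration is a program counter together with the memory contents.
   The machine halts when the counter leaves the program. An invalid indirect
   access leaves the configuration unchanged, so the machine never halts. *)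
Definition exec (R : realType) (N : nat) (i : instr N) (c : nat * 'rV[R]_N)
    : nat * 'rV[R]_N :=
  let: (pc, mu) := c in
  match i with
  | Move x y => (pc.+1, set_cell mu x (mu 0 y))
  | Op o x y z => (pc.+1, set_cell mu x (eval_arith o (mu 0 y) (mu 0 z)))
  | ReadAt x y =>
      if address N (mu 0 y) is Some k then (pc.+1, set_cell mu x (mu 0 k))
      else c
  | WriteAt x y =>
      if address N (mu 0 x) is Some k then (pc.+1, set_cell mu k (mu 0 y))
      else c
  | JumpLe x y l => (if mu 0 x <= mu 0 y then l else pc.+1, mu)
  end.

Definition step (R : realType) (N : nat) (p : seq (instr N))
    (c : nat * 'rV[R]_N) : nat * 'rV[R]_N :=
  if onth p c.1 is Some i then exec i c else c.

(* A streaming algorithm on rows of length m. Its memory consists of an input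
   buffer (the first m cells), an output buffer (the next m cells) and work
   cells; the real constants used by the algorithm are part of the initial
   memory. The same program is run from its first instruction at every
   iteration, and all the memory persists between iterations, except that
   the input buffer is overwritten by the new row. *)
Record streaming_algorithm (R : realType) (m : nat) := StreamingAlgorithm {
  work_cells : nat;
  program : seq (instr (m + (m + work_cells)));
  initial_memory : 'rV[R]_(m + (m + work_cells))
}.

(* The program text is charged as well: otherwise a decision tree on the
   iteration number could hide large tables at no cost. *)
Definition space_used (R : realType) (m : nat) (alg : streaming_algorithm R m)
    : nat :=
  (m + (m + work_cells alg) + size (program alg))%N.

Definition receive (R : realType) (m w : nat) (z : 'rV[R]_m)
    (mu : 'rV[R]_(m + (m + w))) : 'rV[R]_(m + (m + w)) :=
  row_mx z (rsubmx mu).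

Definition output (R : realType) (m w : nat) (mu : 'rV[R]_(m + (m + w)))
    : 'rV[R]_m :=
  lsubmx (rsubmx mu).

(* On the stream of the rows of Z, alg outputs the stream of the rows of W,
   each iteration halting after at most t instructions; mu k is the memory
   after k iterations. *)
Definition streams_within (R : realType) (m : nat)
    (alg : streaming_algorithm R m) (t n : nat) (Z W : 'M[R]_(n, m)) : Prop :=
  exists mu : nat -> 'rV[R]_(m + (m + work_cells alg)),
    mu 0%N = initial_memory alg /\
    forall k : 'I_n,
      exists pc : nat,
        [/\ iter t (step (program alg)) (0%N, receive (row k Z) (mu k))
              = (pc, mu k.+1),
            (size (program alg) <= pc)%N &
            output (mu k.+1) = row k W].

(* Main.v *)
Require Import Defs.
From HB Require Import structures.
From mathcomp Require Import all_boot all_order all_algebra.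
From mathcomp Require Import all_classical all_reals all_analysis.
From mathcomp Require Import ring lra zify.

Set Implicit Arguments.
Unset Strict Implicit.
Unset Printing Implicit Defensive.

Import Order.TTheory GRing.Theory Num.Theory.
Import numFieldNormedType.Exports.

Local Open Scope ring_scope.

(** Put f = (1-x)^(-1/2), with Taylor coefficients f_k = C(2k,k)/4^k. By
discrete orthogonality of cosines f_k is, for k < n, the mean of s^k over the
n points s = (1 + cos(2 pi j/n))/2. Split [0,1] into O(log n) blocks
accumulating geometrically at 1. On the block starting at t, expand
s^k = (t + (s-t))^k by the binomial formula and drop the terms of degree at
least L in s-t: the error is at most 2^(1-L), and the sequence k |-> C(k,l) t^(k-l)
that remains has generating function x^l/(1-tx)^(l+1). So f is, modulo x^n,
within 2^(1-L) of a rational function c = P/Q of degree O(L log n), and the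
hypothesis on d makes L ~ sqrt d sufficient, whence degree O(d).

C is the Toeplitz matrix of c and B that of b = 1/((1-x) c). From
f^2 = 1/(1-x) one gets b = f - v b with v = (1-x) f (c-f), so b is as close to f
as c is, up to a factor n^2 that the hypothesis on d absorbs. Finally
C^-1 Z is the output of the recursive linear filter Q/P, which needs O(d)
registers per column. *)

(** * Taylor coefficients of the inverse square root *)

Definition central (R : realType) (k : nat) : R := 'C(k.*2, k)%:R / 4 ^+ k.

(** From (k+1) C(2k+2,k+1) = 2 (2k+1) C(2k,k). This ratio drives the Taylor coefficients, the bound
    by 1 and the convolution identity. *)
Lemma centralS (R : realType) (k : nat) :
  central R k.+1 * (k.+1)%:R = central R k * (k%:R + 2^-1).
Proof.
have e : (2 * k.*2.+1 * 'C(k.*2, k) = k.+1 * 'C(k.+1.*2, k.+1))%N.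
  rewrite -mul_bin_diag doubleS /=.
  have := mul_bin_down k.*2.+1 k; rewrite /= => e1.
  rewrite -mulnA e1.
  have -> : (k.*2.+1 - k = k.+1)%N by rewrite -addnn; lia.
  by rewrite mulnA mul2n.
rewrite /central exprS invfM.
have {}e : (k.+1)%:R * ('C(k.+1.*2, k.+1))%:R =
    2 * (k%:R * 2 + 1) * ('C(k.*2, k))%:R :> R.
  by rewrite -natrM -e !natrM -[k.*2.+1]addn1 natrD -muln2 natrM.
transitivity ((k.+1)%:R * ('C(k.+1.*2, k.+1))%:R * (4 ^+ k)^-1 / 4 : R); first by ring.
by rewrite e; field; rewrite expf_neq0.
Qed.

Lemma central0 (R : realType) : central R 0 = 1.
Proof. by rewrite /central bin0 expr0 divr1. Qed.

Lemma is_derive_inv_sqrt_pow (R : realType) (p : nat) (x : R) : x < 1 ->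
  is_derive x 1 (fun y : R => (Num.sqrt (1 - y))^-1 ^+ p.+1)
    (p.+1%:R / 2 * (Num.sqrt (1 - x))^-1 ^+ p.+3).
Proof.
move=> x1.
have s0 : 0 < 1 - x by rewrite subr_gt0.
have sq0 : Num.sqrt (1 - x) != 0 by rewrite gt_eqF // sqrtr_gt0.
have d1 : is_derive x 1 (fun y : R => 1 - y) (- 1).
  rewrite -[X in is_derive _ _ _ X]add0r.
  exact: (is_deriveB (is_derive_cst (1 : R) x 1) (is_derive_id x 1)).
have d2 : is_derive x 1 (fun y : R => Num.sqrt (1 - y))
    ((2 * Num.sqrt (1 - x))^-1 * - 1).
  exact: (@is_derive1_comp R Num.sqrt (fun y => 1 - y) x _ _ (is_derive1_sqrt s0) d1).
have d3 := @is_deriveV R (fun y : R => Num.sqrt (1 - y)) x _ 1 sq0 d2.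
have -> : (fun y : R => (Num.sqrt (1 - y))^-1 ^+ p.+1) =
    (fun y : R => (Num.sqrt (1 - y))^-1) ^+ p.+1.
  by apply/funext => y; rewrite exprfctE.
apply: (is_derive_eq (is_deriveX p.+1 d3)); rewrite /GRing.scale /=.
set u := Num.sqrt (1 - x) in sq0 *.
rewrite !exprS !exprVn expr0.
by field; rewrite expf_neq0.
Qed.

Lemma derive1n_inv_sqrt (R : realType) (k : nat) (x : R) : x < 1 ->
  derive1n k (@inv_sqrt_1m R) x =
    central R k * k`!%:R * (Num.sqrt (1 - x))^-1 ^+ k.*2.+1.
Proof.
elim: k x => [|k IH] x x1.
  by rewrite derive1n0 /inv_sqrt_1m div1r central0 !mul1r.
rewrite derive1nS derive1E.
(* The induction hypothesis is an identity on y < 1 only, which suffices near x. *)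
rewrite (near_eq_derive (g := fun y : R =>
   (central R k * k`!%:R) *: (Num.sqrt (1 - y))^-1 ^+ k.*2.+1)) ?oner_neq0 //; last first.
  near=> y; rewrite IH //.
  near: y; exact: lt_nbhsl.
have d := is_derive_inv_sqrt_pow k.*2 x1.
rewrite deriveZ; last exact: ex_derive.
rewrite derive_val.
rewrite /GRing.scale /= doubleS factS natrM mulrA.
rewrite -[X in X%:R / 2]addn1 natrD -muln2 natrM.
transitivity (central R k * (k%:R + 2^-1) * k`!%:R * (Num.sqrt (1 - x))^-1 ^+ (k * 2).+3 : R).
  by field.
by rewrite -centralS; ring.
Unshelve. all: by end_near. Qed.

Lemma taylor_inv_sqrt (R : realType) (k : nat) :
  taylor_coef (@inv_sqrt_1m R) k = central R k.
Proof.
rewrite /taylor_coef derive1n_inv_sqrt ?ltr01 // subr0 sqrtr1 invr1 expr1n mulr1.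
by rewrite mulfK // pnatr_eq0 -lt0n fact_gt0.
Qed.

(** * The coefficients as moments *)

(** Multiplied by 2 sin(t/2), the sum telescopes over r whole periods. As 0 < r < n, t/2 lies
    strictly between 0 and pi, so the sine can be divided out. *)
Lemma sum_cos_eq0 (R : realType) (n r : nat) : (0 < r < n)%N ->
  \sum_(j < n) cos (j%:R * (r%:R * (pi *+ 2 / n%:R))) = 0 :> R.
Proof.
move=> /andP[r0 rn]; set t : R := r%:R * (pi *+ 2 / n%:R).
have n0 : (n%:R : R) != 0 by rewrite pnatr_eq0; lia.
have np : (0 < n)%N by lia.
have th : t / 2 = pi * (r%:R / n%:R) by rewrite /t -mulr_natr; field.
have s0 : sin (t / 2) != 0.
  rewrite gt_eqF // sin_gt0_pi // th mulr_gt0 ?pi_gt0 ?divr_gt0 ?ltr0n //=.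
  by rewrite gtr_pMr ?pi_gt0 // ltr_pdivrMr ?ltr0n // mul1r ltr_nat.
have tele (m : nat) : 2 * sin (t / 2) * (\sum_(j < m) cos (j%:R * t)) =
    sin (m%:R * t - t / 2) + sin (t / 2).
  elim: m => [|m IH]; first by rewrite big_ord0 mulr0 mul0r sub0r sinN addNr.
  rewrite big_ord_recr /= mulrDr IH.
  have -> : m.+1%:R * t - t / 2 = m%:R * t + t / 2.
    by rewrite -addn1 natrD; field.
  by rewrite sinB sinD; ring.
have := tele n.
have -> : n%:R * t - t / 2 = - (t / 2) + pi *+ 2 *+ r.
  by rewrite -(mulr_natr (pi *+ 2) r) /t; field.
have -> : sin (- (t / 2) + pi *+ 2 *+ r) = - sin (t / 2).
  elim: (r) => [|m IH]; first by rewrite mulr0n addr0 sinN.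
  by rewrite (mulrSr (pi *+ 2)) addrA sinD2pi.
by rewrite addNr => /eqP; rewrite !mulf_eq0 (negPf s0) pnatr_eq0 /= => /eqP.
Qed.

(** This is cos(pi j/n)^2. Averaging over these n nodes reproduces the moments of degree below n of
    the arcsine law on [0,1], which are the f_k. *)
Definition chebyshev_node (R : realType) (n j : nat) : R :=
  (1 + cos (j%:R * (pi *+ 2 / n%:R))) / 2.

Lemma chebyshev_node_itv (R : realType) (n j : nat) :
  0 <= chebyshev_node R n j <= 1.
Proof.
rewrite /chebyshev_node.
set c := cos _; have := cos_geN1 (j%:R * (pi *+ 2 / n%:R) : R).
have := cos_le1 (j%:R * (pi *+ 2 / n%:R) : R); rewrite -/c => *.
by apply/andP; split; lra.
Qed.

Lemma node_mul_cos (R : realType) (n j r : nat) :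
  chebyshev_node R n j * cos (j%:R * (r.+1%:R * (pi *+ 2 / n%:R))) =
  cos (j%:R * (r.+1%:R * (pi *+ 2 / n%:R))) / 2 +
  cos (j%:R * (r.+2%:R * (pi *+ 2 / n%:R))) / 4 +
  cos (j%:R * (r%:R * (pi *+ 2 / n%:R))) / 4.
Proof.
rewrite /chebyshev_node; set t := pi *+ 2 / n%:R.
have -> : j%:R * (r.+2%:R * t) = j%:R * (r.+1%:R * t) + j%:R * t.
  by rewrite -addn1 natrD; ring.
have -> : j%:R * (r%:R * t) = j%:R * (r.+1%:R * t) - j%:R * t.
  by rewrite -addn1 natrD; ring.
by rewrite cosD cosB; field.
Qed.

(** Pascal's rule twice; after division by 4 the weights are the 1/2, 1/4, 1/4 of [node_mul_cos]. *)
Lemma binomial_double_step (k r : nat) :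
  ('C(k.+1.*2, k.+1 + r.+1) =
   2 * 'C(k.*2, k + r.+1) + 'C(k.*2, k + r.+2) + 'C(k.*2, k + r))%N.
Proof. by rewrite doubleS !addnS !addSn !binS; lia. Qed.

Lemma binomial_double_step0 (k : nat) :
  ('C(k.+1.*2, k.+1) = 2 * 'C(k.*2, k) + 2 * 'C(k.*2, k.+1))%N.
Proof.
rewrite doubleS !binS; case: k => [|k]; first by rewrite !bin0 !bin_small.
rewrite binS; have := @bin_sub k.+1.*2 k; rewrite -addnn.
have -> : (k.+1 + k.+1 - k = k.+2)%N by lia.
by move=> -> //; lia.
Qed.

(** Multiplication by the node couples the frequency r to r-1 and r+1, as Pascal's rule does for
    C(2k,k+r), so the induction on k covers every r at once. The condition k + r < n prevents
    aliasing modulo n. *)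
Lemma chebyshev_moment_cos (R : realType) (n k r : nat) : (k + r < n)%N ->
  \sum_(j < n) chebyshev_node R n j ^+ k *
    cos (j%:R * (r%:R * (pi *+ 2 / n%:R))) =
  n%:R * ('C(k.*2, k + r)%:R / 4 ^+ k).
Proof.
elim: k r => [|k IH] r krn.
  rewrite add0n bin0n expr0 divr1.
  under eq_bigr do rewrite expr0 mul1r.
  case: r krn => [|r] rn; last by rewrite sum_cos_eq0 ?mulr0.
  under eq_bigr do rewrite mul0r mulr0 cos0.
  by rewrite sumr_const card_ord mulr1.
have e4 : 4 ^+ k != 0 :> R by rewrite expf_neq0.
case: r krn => [|r] krn.
  (* At r = 0 the frequencies -1 and 1 coincide, so their weights add up to 1/2. *)
  have i0 := IH 0%N ltac:(lia); have i1 := IH 1%N ltac:(lia).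
  transitivity ((\sum_(j < n) chebyshev_node R n j ^+ k *
      cos (j%:R * (0%:R * (pi *+ 2 / n%:R)))) / 2 +
    (\sum_(j < n) chebyshev_node R n j ^+ k *
      cos (j%:R * (1%:R * (pi *+ 2 / n%:R)))) / 2).
    rewrite !mulr_suml -big_split; apply: eq_bigr => j _ /=.
    rewrite mul0r mulr0 cos0 !mulr1 mul1r exprS [in LHS]/chebyshev_node.
    by ring.
  rewrite i0 i1 !addn0 binomial_double_step0 addn1 natrD !natrM exprS.
  by field.
have i0 := IH r ltac:(lia); have i1 := IH r.+1 ltac:(lia).
have i2 := IH r.+2 ltac:(lia).
transitivity ((\sum_(j < n) chebyshev_node R n j ^+ k *
      cos (j%:R * (r.+1%:R * (pi *+ 2 / n%:R)))) / 2 +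
    (\sum_(j < n) chebyshev_node R n j ^+ k *
      cos (j%:R * (r.+2%:R * (pi *+ 2 / n%:R)))) / 4 +
    (\sum_(j < n) chebyshev_node R n j ^+ k *
      cos (j%:R * (r%:R * (pi *+ 2 / n%:R)))) / 4).
  rewrite !mulr_suml -!big_split; apply: eq_bigr => j _ /=.
  by rewrite exprSr -[LHS]mulrA node_mul_cos; ring.
rewrite i0 i1 i2 binomial_double_step exprS.
set a := 'C(_, k + r.+1); set b := 'C(_, k + r.+2); set c := 'C(_, k + r).
rewrite (natrD _ (2 * a + b)) (natrD _ (2 * a)) (natrM _ 2).
by field.
Qed.

Lemma central_moment (R : realType) (n k : nat) : (k < n)%N ->
  central R k = n%:R^-1 * \sum_(j < n) chebyshev_node R n j ^+ k.
Proof.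
move=> kn; have := @chebyshev_moment_cos R n k 0; rewrite !addn0 => /(_ kn).
under eq_bigr do rewrite mul0r mulr0 cos0 mulr1.
by move=> ->; rewrite mulKf // pnatr_eq0; lia.
Qed.

(** * Polynomials modulo x^n and Toeplitz matrices *)

(** Congruence modulo x^n. Polynomials stand for power series, since an n by n Toeplitz matrix sees
    only the first n coefficients. *)
Definition eqX (R : realType) (n : nat) (p q : {poly R}) : Prop :=
  forall k : nat, (k < n)%N -> p`_k = q`_k.

Lemma eqXM (R : realType) (n : nat) (p p' q q' : {poly R}) :
  eqX n p p' -> eqX n q q' -> eqX n (p * q) (p' * q').
Proof.
move=> pp qq k kn; rewrite !coefM; apply: eq_bigr => i _.
by rewrite pp ?qq //; have := ltn_ord i; lia.
Qed.

Lemma eqX_trans (R : realType) (n : nat) (p q r : {poly R}) :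
  eqX n p q -> eqX n q r -> eqX n p r.
Proof. by move=> pq qr k kn; rewrite pq // qr. Qed.

Definition toeplitz_mx (R : realType) (n : nat) (p : {poly R}) : 'M[R]_n :=
  \matrix_(i, j) if (j <= i)%N then p`_(i - j) else 0.

Lemma eq_toeplitz_mx (R : realType) (n : nat) (p q : {poly R}) :
  eqX n p q -> toeplitz_mx n p = toeplitz_mx n q.
Proof.
move=> pq; apply/matrixP => i j; rewrite !mxE; case: ifP => // _.
by rewrite pq //; have := ltn_ord i; lia.
Qed.

(** Only j <= l <= i contributes to the entry (i,j); shifting l by j turns the sum into a
    convolution. *)
Lemma toeplitz_mxM (R : realType) (n : nat) (p q : {poly R}) :
  toeplitz_mx n (p * q) = toeplitz_mx n p *m toeplitz_mx n q.
Proof.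
apply/matrixP => i j; rewrite !mxE.
under [RHS]eq_bigr do rewrite !mxE.
pose F l := (if (l <= i)%N then p`_(i - l) else 0) *
            (if (j <= l)%N then q`_(l - j) else 0).
rewrite -(big_mkord xpredT F); case: leqP => ij; last first.
  rewrite big1_seq // => l _; rewrite /F.
  by case: leqP => li; [rewrite [(j <= l)%N]leqNgt (leq_ltn_trans li ij) mulr0 | rewrite mul0r].
rewrite (@big_cat_nat _ _ _ j) ?(ltnW (ltn_ord j)) //=.
rewrite big1_seq ?add0r; last first.
  by move=> l; rewrite mem_index_iota /F /= => lj; rewrite [(j <= l)%N]leqNgt lj mulr0.
rewrite (@big_cat_nat _ _ _ i.+1) ?ltn_ord //=; last by lia.
rewrite [X in _ = _ + X]big1_seq ?addr0; last first.
  by move=> l; rewrite mem_index_iota /F /= => /andP[il _]; rewrite [(l <= i)%N]leqNgt il mul0r.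
rewrite -[X in \sum_(X <= _ < _) _]add0n big_addn subSn // big_mkord coefMr.
apply: eq_bigr => l _; rewrite /F leq_addl addnK.
have li := ltn_ord l; rewrite ifT; last by lia.
by congr (p`_ _ * _); lia.
Qed.

Lemma toeplitz_mx1 (R : realType) (n : nat) : toeplitz_mx n (1 : {poly R}) = 1%:M.
Proof.
apply/matrixP => i j; rewrite !mxE coef1.
have -> : (i == j) = (nat_of_ord i == j) by [].
case: leqP => ij; last by rewrite ltn_eqF.
by rewrite subn_eq0 eqn_leq ij andbT.
Qed.

Lemma toeplitz_mxP (R : realType) (n : nat) (p : {poly R}) :
  is_lt_toeplitz (toeplitz_mx n p).
Proof. by exists (fun k => p`_k) => i j; rewrite mxE. Qed.

Definition geom_poly (R : realType) (n : nat) : {poly R} := \poly_(k < n) 1.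

Lemma ones_ltE (R : realType) (n : nat) : ones_lt R n = toeplitz_mx n (geom_poly R n).
Proof.
apply/matrixP => i j; rewrite !mxE coef_poly; case: (leqP j i) => // ij.
by rewrite ifT // ltn_subLR // ltn_addl.
Qed.

Lemma geom_polyP (R : realType) (n : nat) : eqX n ((1 - 'X) * geom_poly R n) 1.
Proof.
move=> k kn; rewrite mulrBl mul1r coefB coefXM !coef_poly kn coef1.
case: k kn => [|k] kn /=; first by rewrite subr0.
by rewrite ifT ?subrr //; lia.
Qed.

(** Truncated Neumann series: 1 - c is divisible by x, so the remainder (1-c)^n vanishes modulo
    x^n. *)
Lemma invertible_modX (R : realType) (n : nat) (c : {poly R}) : c`_0 = 1 ->
  exists u, eqX n (u * c) 1.
Proof.
move=> c0; exists (\sum_(i < n) (1 - c) ^+ i).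
have [w wE] : exists w, 1 - c = w * 'X.
  exists (\poly_(i < size (1 - c)) (1 - c)`_i.+1).
  apply/polyP => -[|k]; rewrite coefMX /=; first by rewrite coefB coef1 c0 subrr.
  rewrite coef_poly; case: ltnP => // h.
  by rewrite nth_default //; lia.
have -> : (\sum_(i < n) (1 - c) ^+ i) * c = 1 - (1 - c) ^+ n.
  elim: n => [|n IH]; first by rewrite big_ord0 mul0r expr0 subrr.
  by rewrite big_ord_recr /= mulrDl IH exprS; ring.
move=> k kn; rewrite coefB wE exprMn coefMXn kn subr0 //.
Qed.

(** * The identity f^2 = 1/(1-x) and its perturbation *)

Lemma central_ge0 (R : realType) (k : nat) : 0 <= central R k.
Proof. by rewrite divr_ge0 ?exprn_ge0. Qed.

Lemma central_le1 (R : realType) (k : nat) : central R k <= 1.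
Proof.
elim: k => [|k IH]; first by rewrite central0.
have k1 : 0 < k.+1%:R :> R by rewrite ltr0n.
rewrite -(ler_pM2r k1) centralS mul1r -natr1.
apply: (@le_trans _ _ (1 * (k%:R + 2^-1))); last by lra.
by rewrite ler_wpM2r // addr_ge0.
Qed.

(** Coefficient form of 2 x f f' = x (f^2)': pairing i with k - i averages the weight i to k/2. *)
Lemma self_convolution_weighted (R : realType) (f : nat -> R) (k : nat) :
  2 * (\sum_(i < k.+1) i%:R * (f i * f (k - i)%N)) =
  k%:R * \sum_(i < k.+1) f i * f (k - i)%N.
Proof.
rewrite mulr_natl mulr2n [X in X + _](reindex_inj rev_ord_inj) /=.
rewrite -big_split mulr_sumr; apply: eq_bigr => i _ /=.
have ik : (i <= k)%N by rewrite -ltnS.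
rewrite subSS subKn // [f (k - i)%N * _]mulrC -mulrDl; congr (_ * _).
by rewrite -natrD subnK.
Qed.

(* With f_k the coefficients of f = (1-x)^(-1/2): (1-x) f' = f/2 gives
   (1-x) (f^2)' = f^2, so the coefficients of f^2 are constant. *)
Lemma central_convolution (R : realType) (k : nat) :
  \sum_(i < k.+1) central R i * central R (k - i) = 1.
Proof.
elim: k => [|k IH]; first by rewrite big_ord1 central0 mulr1.
have k1 : k.+1%:R != 0 :> R by rewrite pnatr_eq0.
apply: (mulfI k1); rewrite -self_convolution_weighted.
rewrite big_ord_recl mul0r add0r.
under eq_bigr => i _.
  rewrite /= /bump /= add1n subSS mulrA [_ * central R i.+1]mulrC centralS.
  over.
have -> : \sum_(i < k.+1) central R i * (i%:R + 2^-1) * central R (k - i) =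
  \sum_(i < k.+1) i%:R * (central R i * central R (k - i)) +
  2^-1 * \sum_(i < k.+1) central R i * central R (k - i).
  by rewrite mulr_sumr -big_split; apply: eq_bigr => i _ /=; ring.
by rewrite mulrDr self_convolution_weighted IH -natr1; field.
Qed.

Definition central_poly (R : realType) (n : nat) : {poly R} := \poly_(k < n) central R k.

Lemma central_poly_sqr (R : realType) (n : nat) :
  eqX n (central_poly R n * central_poly R n) (geom_poly R n).
Proof.
move=> k kn; rewrite coefM coef_poly kn -(central_convolution R k).
by apply: eq_bigr => i _; rewrite !coef_poly !ifT //; have := ltn_ord i; lia.
Qed.

(* If f^2 = b c = 1/(1-x) and c = f + e, then b = f - v b with v = (1-x) f e. *)
Lemma cofactor_perturbation (R : realType) (n : nat) (c : {poly R}) (eps : R) :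
  c`_0 = 1 -> (forall k, (k < n)%N -> `|c`_k - central R k| <= eps) ->
  4 * n%:R ^+ 2 * eps <= 1 ->
  exists b u, [/\ eqX n (b * c) (geom_poly R n), eqX n (u * c) 1 &
    forall k, (k < n)%N -> `|b`_k - central R k| <= 4 * n%:R ^+ 2 * eps].
Proof.
move=> c0 ce small.
have [u uc] := invertible_modX n c0.
pose f : {poly R} := central_poly R n; pose b : {poly R} := geom_poly R n * u.
have bc : eqX n (b * c) (geom_poly R n).
  rewrite -[X in eqX _ _ X]mulr1 /b -mulrA; exact: eqXM.
exists b, u; split=> //.
case: n => [//|n] in f b small uc bc ce *.
pose v : {poly R} := (1 - 'X) * (f * (c - f)).
have eps0 : 0 <= eps by apply: le_trans (ce 0%N _).
have bE : eqX n.+1 (b + v * b) f.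
  (* Modulo x^n the last bracket vanishes because (1-x) f^2 = 1, and the first term reduces to f
     because (1-x) b c = 1. *)
  have -> : b + v * b = b * c * ((1 - 'X) * f) + b * (1 - (1 - 'X) * (f * f)).
    by rewrite /v; ring.
  move=> k kn; rewrite coefD.
  have -> : (b * (1 - (1 - 'X) * (f * f)))`_k = 0.
    transitivity ((b * 0)`_k); last by rewrite mulr0 coef0.
    apply: (eqXM (n := n.+1)) => // j jn.
    rewrite coefB (_ : ((1 - 'X) * (f * f))`_j = (1 : {poly R})`_j) ?coef0 ?subrr //.
    by rewrite -(geom_polyP R jn); apply: (eqXM (n := n.+1)) => //; exact: central_poly_sqr.
  rewrite addr0.
  have -> : b * c * ((1 - 'X) * f) = ((1 - 'X) * (b * c)) * f by ring.
  transitivity ((1 * f)`_k); last by rewrite mul1r.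
  apply: (eqXM (n := n.+1)) => //.
  apply: (@eqX_trans _ _ _ ((1 - 'X) * geom_poly R n.+1)); last exact: geom_polyP.
  exact: eqXM.
have e_le k : (k < n.+1)%N -> `|(c - f)`_k| <= eps.
  by move=> kn; rewrite coefB coef_poly kn ce.
have fe_le k : (k < n.+1)%N -> `|(f * (c - f))`_k| <= n.+1%:R * eps.
  move=> kn; rewrite coefM; apply: le_trans (ler_norm_sum _ _ _) _.
  apply: (@le_trans _ _ (\sum_(i < k.+1) eps)); last first.
    by rewrite sumr_const card_ord -[leLHS]mulr_natl ler_wpM2r // ler_nat.
  apply: ler_sum => i _; have := ltn_ord i => ik.
  rewrite normrM -[leRHS]mul1r ler_pM // ?e_le ?coef_poly //; try lia.
  rewrite ifT; last by lia.
  by rewrite ger0_norm ?central_ge0 ?central_le1.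
have v_le k : (k < n.+1)%N -> `|v`_k| <= 2 * n.+1%:R * eps.
  move=> kn; rewrite /v mulrBl mul1r coefB coefXM.
  apply: le_trans (ler_normB _ _) _; rewrite -mulrA mulr_natl mulr2n lerD ?fe_le //.
  case: k kn => [|k] kn; last by rewrite fe_le //; lia.
  by rewrite normr0 mulr_ge0.
have v0 : v`_0 = 0.
  rewrite /v mulrBl mul1r coefB coefXM subr0 coefM big_ord1.
  by rewrite coefB c0 [X in _ - X]coef_poly /= central0 subrr mulr0.
have bfv k : (k < n.+1)%N -> b`_k - central R k = - \sum_(i < k) v`_i.+1 * b`_(k - i.+1).
  move=> kn; have := bE k kn; rewrite coefD [f`_k]coef_poly kn => <-.
  by rewrite opprD addNKr coefM big_ord_recl v0 mul0r add0r.
(* Strong induction: as v_0 = 0, only earlier coefficients of b occur, and the smallness hypothesis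
   bounds each of them by 1 + 1 = 2. *)
have main k : (k < n.+1)%N -> `|b`_k - central R k| <= 4 * n.+1%:R ^+ 2 * eps.
  elim/ltn_ind: k => k IH kn; rewrite bfv // normrN.
  apply: le_trans (ler_norm_sum _ _ _) _.
  apply: (@le_trans _ _ (\sum_(i < k) 4 * n.+1%:R * eps)); last first.
    rewrite sumr_const card_ord -[leLHS]mulr_natr.
    have : k%:R <= n.+1%:R :> R by rewrite ler_nat ltnW.
    have : 0 <= n.+1%:R * eps by rewrite mulr_ge0.
    by nra.
  apply: ler_sum => i _; have := ltn_ord i => ik.
  have b2 : `|b`_(k - i.+1)| <= 2.
    rewrite -[b`_ _](subrK (central R (k - i.+1))).
    apply: le_trans (ler_normD _ _) _.
    have : `|b`_(k - i.+1) - central R (k - i.+1)| <= 1.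
      by apply: le_trans small; apply: IH; lia.
    rewrite [X in _ + X <= _]ger0_norm ?central_ge0 //.
    by have := central_le1 R (k - i.+1); lra.
  rewrite normrM (_ : 4 * _ * eps = 2 * n.+1%:R * eps * 2); last by ring.
  by rewrite ler_pM // v_le //; lia.
exact: main.
Qed.

(** * Rational approximation *)

(** Each dropped term has l >= L, hence e^l <= (2e)^l / 2^L, and the binomial sum with 2e in place
    of e collects the bounds. *)
Lemma truncated_binomial_error (R : realType) (t e : R) (k L : nat) :
  0 <= t -> 0 <= e ->
  `|\sum_(l < L) 'C(k, l)%:R * t ^+ (k - l) * e ^+ l - (t + e) ^+ k| <=
    (t + 2 * e) ^+ k / 2 ^+ L.
Proof.
move=> t0 e0.
(* The range is padded with zero terms beyond k, so that it can be cut at L whether or not L <=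
   k. *)
have full (x : R) : (t + x) ^+ k =
    \sum_(0 <= l < L + k.+1) 'C(k, l)%:R * t ^+ (k - l) * x ^+ l.
  rewrite exprDn -(big_mkord xpredT (fun l => t ^+ (k - l) * x ^+ l *+ 'C(k, l))).
  rewrite [RHS](@big_cat_nat _ _ _ k.+1) ?leq_addl //=.
  rewrite [X in _ = _ + X]big1_seq ?addr0; last first.
    by move=> l; rewrite mem_index_iota => /andP[_ /andP[kl _]]; rewrite bin_small // !mul0r.
  by apply: eq_bigr => l _; rewrite -mulrA mulr_natl.
rewrite !full -(big_mkord xpredT (fun l => 'C(k, l)%:R * t ^+ (k - l) * e ^+ l)).
rewrite ![\sum_(0 <= _ < L + k.+1) _](@big_cat_nat _ _ _ L) ?leq_addr //=.
rewrite opprD addNKr normrN ger0_norm; last first.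
  by apply: sumr_ge0 => l _; rewrite !mulr_ge0 ?exprn_ge0.
have p2 : 0 < 2 ^+ L :> R by rewrite exprn_gt0.
rewrite ler_pdivlMr // mulr_suml.
apply: (@le_trans _ _ (\sum_(L <= l < L + k.+1) 'C(k, l)%:R * t ^+ (k - l) * (2 * e) ^+ l)); last first.
  by rewrite lerDr; apply: sumr_ge0 => l _; rewrite !mulr_ge0 ?exprn_ge0 ?mulr_ge0.
rewrite big_seq [leRHS]big_seq; apply: ler_sum => l.
rewrite mem_index_iota => /andP[Ll _]; rewrite exprMn -[leLHS]mulrA.
rewrite ler_wpM2l ?mulr_ge0 ?exprn_ge0 // mulrC ler_wpM2r ?exprn_ge0 //.
by rewrite ler_weXn2l // ler1n.
Qed.

(* Coefficients of x^l / (1 - t x)^(l+1). *)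
Definition pole_poly (R : realType) (n : nat) (t : R) (l : nat) : {poly R} :=
  \poly_(k < n) ('C(k, l)%:R * t ^+ (k - l)).

(** By Pascal's rule, multiplying by 1 - t x lowers l by one and leaves a factor x; the induction
    starts from the geometric series. *)
Lemma pole_polyP (R : realType) (n : nat) (t : R) (l : nat) :
  eqX n ((1 - t *: 'X) ^+ l.+1 * pole_poly n t l) 'X^l.
Proof.
elim: l => [|l IH].
  move=> k kn; rewrite expr1 mulrBl mul1r -scalerAl coefB coefZ coefXM !coef_poly kn.
  rewrite coefXn bin0 mul1r subn0.
  case: k kn => [|k] kn /=; first by rewrite mulr0 subr0.
  by rewrite ifT ?bin0 ?mul1r ?subn0 -?exprS ?subrr //; lia.
have step : eqX n ((1 - t *: 'X) * pole_poly n t l.+1) ('X * pole_poly n t l).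
  move=> k kn; rewrite mulrBl mul1r -scalerAl coefB coefZ !coefXM !coef_poly kn.
  case: k kn => [|k] kn /=; first by rewrite bin0n mul0r mulr0 subr0.
  have -> : (k < n)%N by lia.
  rewrite subSS binS natrD mulrDl.
  have [kl|lk] := leqP k l; first by rewrite bin_small // !mul0r mulr0 add0r subr0.
  rewrite mulrCA -exprS (_ : (k - l.+1).+1 = (k - l)%N); last by lia.
  by rewrite addrAC subrr add0r.
rewrite exprSr -mulrA.
apply: (@eqX_trans _ _ _ ((1 - t *: 'X) ^+ l.+1 * ('X * pole_poly n t l))).
  exact: eqXM.
rewrite mulrCA [X in eqX _ _ X]exprS; exact: eqXM.
Qed.

(** Q is a parameter: with a common denominator, linear combinations do not raise the degree
    bound. *)
Definition rational_mod (R : realType) (n D : nat) (Q c : {poly R}) : Prop :=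
  exists2 P : {poly R}, (size P <= D)%N & eqX n (Q * c) P.

Lemma rational_mod_sum (R : realType) (n D : nat) (Q : {poly R}) (I : Type)
    (r : seq I) (c : I -> {poly R}) (w : I -> R) :
  (forall i, rational_mod n D Q (c i)) ->
  rational_mod n D Q (\sum_(i <- r) w i *: c i).
Proof.
move=> rc; elim/big_rec: _ => [|i x _ [P Ps PE]].
  by exists 0; rewrite ?size_poly0 // mulr0.
have [P' Ps' PE'] := rc i.
exists (w i *: P' + P).
  rewrite (leq_trans (size_polyD _ _)) // geq_max Ps andbT.
  exact: leq_trans (size_scale_leq _ _) Ps'.
by move=> k kn; rewrite mulrDr -scalerAr !coefD !coefZ PE // PE'.
Qed.

Lemma size_mul_deg (R : realType) (p q : {poly R}) (a b : nat) :
  (size p <= a.+1)%N -> (size q <= b.+1)%N -> (size (p * q)%R <= (a + b).+1)%N.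
Proof. by move=> pa qb; apply: leq_trans (size_polyMleq _ _) _; lia. Qed.

Lemma size_pole (R : realType) (t : R) (k : nat) :
  (size ((1 - t *: 'X) ^+ k)%R <= k.+1)%N.
Proof.
elim: k => [|k IH]; first by rewrite expr0 size_poly1.
rewrite exprS -[k.+1]add1n; apply: size_mul_deg IH.
rewrite (leq_trans (size_polyD _ _)) // geq_max size_poly1 /= size_polyN.
by rewrite (leq_trans (size_scale_leq _ _)) // size_polyX.
Qed.

(** The factor (1 - t_i x)^(l+1) of the common denominator cancels the pole; the numerator left has
    degree at most (L-l-1) + M L + l. *)
Lemma pole_rational (R : realType) (n M L l : nat) (t : nat -> R) (i : 'I_M.+1) :
  (l < L)%N ->
  rational_mod n (M.+1 * L) (\prod_(j < M.+1) (1 - t j *: 'X) ^+ L) (pole_poly n (t i) l).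
Proof.
move=> lL; rewrite (bigD1 i) //= -(subnK lL) exprD.
set Q := \prod_(j < _ | _) _.
exists (((1 - t i *: 'X) ^+ (L - l.+1) * Q) * 'X^l); last first.
  set a := _ ^+ (L - _); set b := _ ^+ l.+1.
  rewrite (_ : a * b * Q * _ = a * Q * (b * pole_poly n (t i) l)); last by ring.
  by apply: eqXM => //; exact: pole_polyP.
have sQ : (size Q <= (M * L).+1)%N.
  have -> : (M * L = \sum_(j < M.+1 | j != i) L)%N.
    by rewrite sum_nat_const cardC1 card_ord.
  apply: (big_ind2 (fun (p : {poly R}) d => (size p <= d.+1)%N)) => //.
  - by rewrite size_poly1.
  - by move=> p a q b; exact: size_mul_deg.
  - by move=> j _; rewrite subnK // size_pole.
have := size_mul_deg (size_mul_deg (size_pole (t i) (L - l.+1)) sQ) (_ : size 'X^l <= l.+1)%N.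
rewrite size_polyXn leqnn => /(_ isT); rewrite subnK //.
by move/leq_trans; apply; rewrite mulSn; lia.
Qed.

(* Splits [0, 1] geometrically towards its right end, up to the scale 1/(2n)
   at which x^k, k < n, no longer varies. *)
Lemma geometric_block (R : realType) (n M : nat) (s : R) :
  0 <= s <= 1 -> 2 * n%:R * (2 / 3) ^+ M <= 1 :> R ->
  exists i : 'I_M.+1, let a := (2 / 3) ^+ i in
    [/\ 0 <= 1 - a, 1 - a <= s &
        n%:R * ((1 - a) + 2 * (s - (1 - a)) - 1) <= 2^-1].
Proof.
move=> /andP[s0 s1] nM.
have pw i : 0 <= (2 / 3 : R) ^+ i <= 1.
  by rewrite exprn_ge0 ?exprn_ile1 //; lra.
have [le|lt] := leP (1 - s) ((2 / 3) ^+ M).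
  (* Last block, t = 1 - a: the excess t + 2(s-t) - 1 is at most a, and n a <= 1/2. *)
  exists ord_max => /=; have := pw M; move: le nM; set a := _ ^+ M.
  move=> le nM /andP[a0 a1]; split; try lra.
  have : n%:R * (1 - a + 2 * (s - (1 - a)) - 1) <= n%:R * a :> R.
    by rewrite ler_wpM2l //; lra.
  by move/le_trans; apply; lra.
have [i iM [ile igt]] : exists2 i, (i < M)%N &
    1 - s <= (2 / 3) ^+ i /\ (2 / 3) ^+ i.+1 < 1 - s.
  elim: M lt {nM} => [|M IH] lt; first by move: lt; rewrite expr0; lra.
  have [le|/IH[i iM h]] := leP (1 - s) ((2 / 3) ^+ M); first by exists M.
  by exists i => //; lia.
(* Here s - t = a - (1-s) < a/3, so t + 2(s-t) stays below 1. *)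
exists (Ordinal (ltnW iM : i < M.+1)%N) => /=.
have := pw i; move: ile igt; rewrite exprS; set a := _ ^+ i => ile igt /andP[a0 a1].
split; try lra.
have : n%:R * (1 - a + 2 * (s - (1 - a)) - 1) <= n%:R * 0 :> R.
  by rewrite ler_wpM2l //; lra.
by move/le_trans; apply; lra.
Qed.

(** y^k <= exp(k (y-1)) <= exp(1/2) <= 2, the last because exp(-1/2) >= 1 - 1/2. *)
Lemma expr_le2 (R : realType) (n k : nat) (y : R) :
  0 <= y -> n%:R * (y - 1) <= 2^-1 -> (k < n)%N -> y ^+ k <= 2.
Proof.
move=> y0 ny kn.
have h : 1 <= 2 * expR (- 2^-1) :> R by have := expR_ge1Dx (- 2^-1 : R); lra.
have p : 0 < expR (- 2^-1) :> R by exact: expR_gt0.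
rewrite -(ler_pM2r p); apply: le_trans h; rewrite expRN ler_pdivrMr ?expR_gt0 // mul1r.
apply: le_trans (_ : _ <= expR (y - 1) ^+ k) _.
  by apply: lerXn2r; rewrite ?nnegrE ?expR_ge0 //; have := expR_ge1Dx (y - 1); lra.
rewrite -expRM_natl ler_expR.
have [y1|y1] := leP y 1.
  by apply: (@le_trans _ _ 0); [rewrite mulr_ge0_le0 // subr_le0 | ].
apply: le_trans ny; rewrite ler_wpM2r ?subr_ge0 ?ler_nat ?(ltnW kn) //; exact: ltW.
Qed.

Lemma rational_approximation (R : realType) (n M L : nat) :
  (0 < n)%N -> (0 < L)%N -> 2 * n%:R * (2 / 3) ^+ M <= 1 :> R ->
  exists c P Q : {poly R},
    [/\ eqX n (Q * c) P, c`_0 = 1, Q`_0 = 1,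
        (size P <= (M.+1 * L).+1)%N /\ (size Q <= (M.+1 * L).+1)%N &
        forall k, (k < n)%N -> `|c`_k - central R k| <= 2 / 2 ^+ L].
Proof.
move=> n0 L0 nM.
pose t i : R := 1 - (2 / 3) ^+ i.
pose s (j : 'I_n) : R := chebyshev_node R n j.
have /boolp.choice[b bP] : forall j, exists i : 'I_M.+1,
    [/\ 0 <= t i, t i <= s j & n%:R * (t i + 2 * (s j - t i) - 1) <= 2^-1].
  by move=> j; exact: geometric_block (chebyshev_node_itv R n j) nM.
(* The average over the nodes s of s^k, expanded at the left end of the block of s and cut at degree
   L. *)
pose c := \sum_(j < n) n%:R^-1 *:
  \sum_(l < L) (s j - t (b j)) ^+ l *: pole_poly n (t (b j)) l.
pose Q := \prod_(i < M.+1) (1 - t i *: 'X : {poly R}) ^+ L.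
have [P sP QcP] : rational_mod n (M.+1 * L) Q c.
  apply: rational_mod_sum => j; apply: rational_mod_sum => l.
  exact: pole_rational.
have cE k : (k < n)%N -> c`_k = n%:R^-1 * \sum_(j < n) \sum_(l < L)
    'C(k, l)%:R * t (b j) ^+ (k - l) * (s j - t (b j)) ^+ l.
  move=> kn; rewrite coef_sum mulr_sumr; apply: eq_bigr => j _.
  rewrite coefZ coef_sum; congr (_ * _); apply: eq_bigr => l _.
  by rewrite coefZ coef_poly kn mulrC.
have nn : n%:R != 0 :> R by rewrite pnatr_eq0; lia.
exists c, P, Q; split=> //.
(* At k = 0 only l = 0 survives, so the truncation is exact; this is where 0 < L matters. *)
- rewrite cE //; under eq_bigr => j _.
    rewrite (bigD1 (Ordinal L0)) //= bin0 expr0 sub0n expr0 !mul1r big1 ?addr0.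
      over.
    move=> l /eqP l0; rewrite bin_small ?mul0r //.
    by case: l l0 => [[|l] lL] // []; exact: val_inj.
  by rewrite sumr_const card_ord mulVf.
- rewrite -horner_coef0 horner_prod big1 // => i _.
  by rewrite !hornerE ?mulr0 ?subr0 ?expr1n.
- split; first by rewrite (leq_trans sP).
  have -> : (M.+1 * L = \sum_(i < M.+1) L)%N by rewrite sum_nat_const card_ord.
  apply: (big_ind2 (fun (p : {poly R}) d => (size p <= d.+1)%N)) => //.
  + by rewrite size_poly1.
  + by move=> p x q y; exact: size_mul_deg.
  + by move=> j _; exact: size_pole.
- move=> k kn; rewrite cE // (central_moment R kn) -mulrBr -sumrB normrM.
  rewrite ger0_norm ?invr_ge0 // mulrC ler_pdivrMr ?ltr0n //.
  apply: le_trans (ler_norm_sum _ _ _) _.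
  apply: le_trans (_ : _ <= \sum_(j < n) 2 / 2 ^+ L) _; last first.
    by rewrite sumr_const card_ord -[leLHS]mulr_natr.
  apply: ler_sum => j _; have [t0 ts h] := bP j.
  have e0 : 0 <= s j - t (b j) by rewrite subr_ge0.
  have := truncated_binomial_error k L t0 e0.
  rewrite [t (b j) + (s j - _)]addrC subrK => /le_trans; apply.
  rewrite ler_pM2r ?invr_gt0 ?exprn_gt0 //.
  by apply: (expr_le2 _ h kn); rewrite addr_ge0 ?mulr_ge0.
Qed.

(** * Perturbation of the norms *)

(** Minkowski's inequality with a uniform bound on a - b: expand the squares of |b_i| + e and bound
    the cross term by Cauchy-Schwarz. *)
Lemma sqrt_sum_sqr_perturbation (R : realType) (n : nat) (a b : 'I_n -> R) (e : R) :
  0 <= e -> (forall i, `|a i - b i| <= e) ->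
  Num.sqrt (\sum_i a i ^+ 2) <= Num.sqrt (\sum_i b i ^+ 2) + Num.sqrt n%:R * e.
Proof.
move=> e0 ab.
set S := Num.sqrt (\sum_i b i ^+ 2).
have S0 : 0 <= S by rewrite sqrtr_ge0.
have SE : S ^+ 2 = \sum_i b i ^+ 2 by rewrite sqr_sqrtr // sumr_ge0 // => i _; rewrite sqr_ge0.
have q0 : 0 <= Num.sqrt n%:R :> R by rewrite sqrtr_ge0.
have qE : Num.sqrt n%:R ^+ 2 = n%:R :> R by rewrite sqr_sqrtr.
have T0 : 0 <= S + Num.sqrt n%:R * e by rewrite addr_ge0 ?mulr_ge0.
rewrite -(ger0_norm T0) -sqrtr_sqr ler_sqrt ?sqr_ge0 //.
set X := \sum_i `|b i|.
have X0 : 0 <= X by apply: sumr_ge0.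
(* Cauchy-Schwarz against the constant sequence. *)
have XS : X <= Num.sqrt n%:R * S.
  rewrite -(ger0_norm X0) -sqrtr_sqr -sqrtrM // -[in leRHS]SE.
  rewrite ler_sqrt ?mulr_ge0 ?sqr_ge0 // SE.
  (* Lagrange's identity: this double sum is twice the Cauchy-Schwarz defect. *)
  have : 0 <= \sum_i \sum_j (`|b i| - `|b j|) ^+ 2.
    by apply: sumr_ge0 => i _; apply: sumr_ge0 => j _; rewrite sqr_ge0.
  have -> : \sum_i \sum_j (`|b i| - `|b j|) ^+ 2 =
      2 * (n%:R * \sum_i b i ^+ 2) - 2 * X ^+ 2.
    transitivity (\sum_i (n%:R * b i ^+ 2 + \sum_j b j ^+ 2 - 2 * (X * `|b i|))).
      apply: eq_bigr => i _; rewrite mulrA /X mulr_sumr mulr_suml.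
      rewrite (_ : n%:R * b i ^+ 2 = \sum_(j < n) b i ^+ 2); last first.
        by rewrite sumr_const card_ord mulr_natl.
      rewrite -big_split -sumrB; apply: eq_bigr => j _ /=.
      by rewrite -(real_normK (num_real (b i))) -(real_normK (num_real (b j))); ring.
    rewrite sumrB big_split /= -!mulr_sumr sumr_const card_ord -/X.
    by rewrite -[X in _ + X - _]mulr_natl; ring.
  by lra.
apply: le_trans (_ : _ <= \sum_i (b i ^+ 2 + 2 * e * `|b i| + e ^+ 2)) _.
  apply: ler_sum => i _; rewrite -[a i](subrK (b i)).
  have h : `|a i - b i + b i| <= e + `|b i|.
    by apply: le_trans (ler_normD _ _) _; rewrite lerD2r.
  rewrite -(real_normK (num_real (a i - b i + b i))).
  apply: (@le_trans _ _ ((e + `|b i|) ^+ 2)); last first.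
    by rewrite -[b i ^+ 2](real_normK (num_real (b i))); rewrite le_eqVlt; apply/orP; left; apply/eqP; ring.
  by apply: lerXn2r; rewrite ?nnegrE ?addr_ge0.
rewrite !big_split /= -SE -mulr_sumr sumr_const card_ord -[e ^+ 2 *+ n]mulr_natl -/X.
rewrite sqrrD exprMn qE lerD2r lerD2l -[leRHS]mulr_natl.
by rewrite -mulrA ler_wpM2l // (mulrC S) -mulrA mulrCA ler_wpM2l.
Qed.

Lemma norm_2_infty_perturbation (R : realType) (n : nat) (A B : 'M[R]_n) (e : R) :
  0 <= e -> (forall i j, `|A i j - B i j| <= e) ->
  norm_2_infty A <= norm_2_infty B + Num.sqrt n%:R * e.
Proof.
move=> e0 AB; rewrite /norm_2_infty.
have B0 : 0 <= \big[Num.max/0]_(i < n) Num.sqrt (\sum_(j < n) B i j ^+ 2).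
  by elim/big_rec: _ => // i x _ x0; rewrite le_max x0 orbT.
apply: (big_ind (fun x => x <= _)) => [|x y xl yl|i _].
- by rewrite addr_ge0 ?mulr_ge0 ?sqrtr_ge0.
- by rewrite ge_max xl.
apply: le_trans (sqrt_sum_sqr_perturbation e0 (AB i)) _.
by rewrite lerD2r (le_bigmax _ (fun i => Num.sqrt (\sum_j B i j ^+ 2))).
Qed.

Lemma norm_1_2_tr (R : realType) (n : nat) (A : 'M[R]_n) :
  norm_1_2 A = norm_2_infty A^T.
Proof.
by apply: eq_bigr => j _; congr Num.sqrt; apply: eq_bigr => i _; rewrite mxE.
Qed.

(** * Straight-line programs *)

Section straight_line.
Variables (R : realType) (m : nat) (W : finType).

(* The input buffer, the output buffer and the work cells. *)
Let cell := ('I_m + ('I_m + W))%type.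
Let memory := 'rV[R]_(m + (m + #|W|)).

Definition cell_index (c : cell) : 'I_(m + (m + #|W|)) :=
  match c with
  | inl r => lshift _ r
  | inr (inl r) => rshift m (lshift _ r)
  | inr (inr u) => rshift m (rshift m (enum_rank u))
  end.

Lemma cell_index_inj : injective cell_index.
Proof.
move=> [r|[r|u]] [r'|[r'|u']] /= /eqP; rewrite ?eq_lshift ?eq_rshift ?eq_lrshift ?eq_rlshift //=;
  rewrite ?eq_lshift ?eq_rshift ?eq_lrshift ?eq_rlshift //=.
- by move=> /eqP ->.
- by move=> /eqP ->.
- by move=> /eqP /enum_rank_inj ->.
Qed.

Definition read (mu : memory) (c : cell) : R := mu 0 (cell_index c).

Definition assignment := (arith * cell * cell * cell)%type.

Definition assign (env : cell -> R) (a : assignment) : cell -> R :=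
  let: (o, x, y, z) := a in
  fun c => if c == x then eval_arith o (env y) (env z) else env c.

Definition compile (a : assignment) : instr (m + (m + #|W|)) :=
  let: (o, x, y, z) := a in
  Op o (cell_index x) (cell_index y) (cell_index z).

Lemma step_compile (p : seq assignment) (pc : nat) (mu : memory) a :
  onth p pc = Some a ->
  exists mu', step (map compile p) (pc, mu) = (pc.+1, mu') /\
              read mu' =1 assign (read mu) a.
Proof.
move=> pa; case: a pa => [[[op x] y] z] pa.
rewrite /step /= onth_map pa /=.
eexists; split; first by [].
move=> c; rewrite /read /set_cell !mxE /= (inj_eq cell_index_inj).
by case: eqP.
Qed.

Lemma iter_compile (p : seq assignment) (mu : memory) (t : nat) :
  (size p <= t)%N ->
  exists mu', iter t (step (map compile p)) (0%N, mu) = (size p, mu') /\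
              read mu' =1 foldl assign (read mu) p.
Proof.
move=> pt.
(* A counter equal to the program length is a fixed point, so surplus time is harmless. *)
have halted mu' t' : iter t' (step (map compile p)) (size p, mu') = (size p, mu').
  elim: t' => //= t' ->.
  by rewrite /step onth_map onth_default.
rewrite -(subnK pt) iterD.
suff [mu' [-> e]] : exists mu', iter (size p) (step (map compile p)) (0%N, mu) =
    (size p, mu') /\ read mu' =1 foldl assign (read mu) p.
  by exists mu'.
suff H k : (k <= size p)%N -> exists mu',
    iter k (step (map compile p)) (0%N, mu) = (k, mu') /\
    read mu' =1 foldl assign (read mu) (take k p).
  by have := H _ (leqnn _); rewrite take_size.
elim: k => [|k IH] kp; first by rewrite take0; exists mu.
have [mu' [e1 e2]] := IH (ltnW kp).
have [a pa] : exists a, onth p k = Some a.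
  by case e: (onth p k) => [a|]; [exists a | move: (onthTE p k); rewrite e kp].
have [mu'' [e3 e4]] := step_compile mu' pa.
exists mu''; rewrite iterS e1 e3; split=> // c; rewrite e4.
have -> : take k.+1 p = rcons (take k p) a.
  by rewrite (take_nth a) //; congr rcons; exact: onth_nth.
rewrite foldl_rcons /=; case: (a) => [[[op x] y] z] /=.
by rewrite !e2.
Qed.

End straight_line.

(** * Streaming a rational filter *)

Section filter.
Variables (R : realType) (m D : nat).

(* A scratch cell, the coefficients of Q and of P, and D + 1 registers per
   column; the last register of a column is never written and holds 0. *)
Let work := (unit + ('I_D.+1 + 'I_D.+1) + 'I_D.+1 * 'I_m)%type.
Let cell := ('I_m + ('I_m + work))%type.

Let inp (r : 'I_m) : cell := inl r.
Let out (r : 'I_m) : cell := inr (inl r).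
Let tmp : cell := inr (inr (inl (inl tt))).
Let coef_q (i : nat) : cell := inr (inr (inl (inr (inl (inord i))))).
Let coef_p (i : nat) : cell := inr (inr (inl (inr (inr (inord i))))).
Let reg (i : nat) (r : 'I_m) : cell := inr (inr (inr (inord i, r))).

(** Run for increasing i, so that register i + 1 still holds its old value when register i absorbs
    it; the output must already be in place. *)
Definition update_register (r : 'I_m) (i : nat) : seq (assignment m work) :=
  [:: (Mul, tmp, coef_q i.+1, inp r);
      (Add, reg i r, reg i.+1 r, tmp);
      (Mul, tmp, coef_p i.+1, out r);
      (Defs.Sub, reg i r, reg i r, tmp)].

Definition filter_column (r : 'I_m) : seq (assignment m work) :=
  (Add, out r, inp r, reg 0 r) ::
  flatten [seq update_register r i | i <- iota 0 D].

Definition filter_program : seq (assignment m work) :=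
  flatten [seq filter_column r | r <- enum 'I_m].

Lemma size_filter_program : size filter_program = (m * (1 + 4 * D))%N.
Proof.
rewrite /filter_program size_flatten /shape -map_comp sumnE big_map.
rewrite (eq_bigr (fun=> 1 + 4 * D)%N) ?big_const_seq ?count_predT; last first.
  move=> r _; rewrite /= size_flatten /shape -map_comp sumnE big_map /=.
  by rewrite big_const_seq count_predT size_iota iter_addn_0.
by rewrite iter_addn_0 -cardE card_ord mulnC.
Qed.

Lemma update_registerE (e : cell -> R) (r : 'I_m) (i : nat) (c : cell) :
  c != tmp ->
  foldl (@assign R m work) e (update_register r i) c =
  if c == reg i r then
    e (reg i.+1 r) + e (coef_q i.+1) * e (inp r) - e (coef_p i.+1) * e (out r)
  else e c.
Proof.
move=> /negPf ct; rewrite /= ct eqxx.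
by case: eqP.
Qed.

Lemma update_registersE (e : cell -> R) (r : 'I_m) (j : nat) (c : cell) :
  (j <= D)%N -> c != tmp ->
  foldl (@assign R m work) e (flatten [seq update_register r i | i <- iota 0 j]) c =
  if c is inr (inr (inr (i, r'))) then
    if (r' == r) && (i < j)%N then
      e (reg i.+1 r) + e (coef_q i.+1) * e (inp r) - e (coef_p i.+1) * e (out r)
    else e c
  else e c.
Proof.
elim: j c => [|j IH] c jD ct.
  by case: c ct => [?|[?|[?|[i r']]]] //= _; rewrite andbF.
rewrite -[j.+1]addn1 iotaD map_cat flatten_cat foldl_cat add0n.
rewrite (_ : flatten [seq update_register r i | i <- iota j 1] = update_register r j) //.
rewrite update_registerE // !IH ?(ltnW jD) //=.
have inj : (inord j.+1 : 'I_D.+1) = j.+1 :> nat by rewrite inordK.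
have inj' : (inord j : 'I_D.+1) = j :> nat by rewrite inordK //; lia.
rewrite inj ltnNge leqnSn andbF.
case: c ct => [?|[?|[?|[i r']]]] //= _.
have -> : (inr (inr (inr (i, r'))) == reg j r :> cell) = (i == inord j) && (r' == r) by [].
have -> : (i == inord j) = (nat_of_ord i == j) by rewrite -val_eqE /= inj'.
rewrite addn1 ltnS [(i <= j)%N]leq_eqVlt andbC.
by case: (r' == r) => //=; case: (nat_of_ord i =P j) => //= ->.
Qed.

Lemma filter_columnE (e : cell -> R) (r : 'I_m) (c : cell) :
  c != tmp ->
  foldl (@assign R m work) e (filter_column r) c =
  match c with
  | inr (inl r') => if r' == r then e (inp r) + e (reg 0 r) else e c
  | inr (inr (inr (i, r'))) =>
      if (r' == r) && (i < D)%N then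
        e (reg i.+1 r) + e (coef_q i.+1) * e (inp r)
          - e (coef_p i.+1) * (e (inp r) + e (reg 0 r))
      else e c
  | _ => e c
  end.
Proof.
move=> ct; rewrite [foldl _ _ _]/= update_registersE //.
case: c ct => [?|[?|[?|[i r']]]] //= _.
by rewrite eqxx.
Qed.

(** Distinct columns share, apart from read-only coefficients, just the scratch cell, which is
    written before it is read; hence every right-hand side refers to the initial state [e]. *)
Lemma filter_columnsE (e : cell -> R) (s : seq 'I_m) (c : cell) :
  uniq s -> c != tmp ->
  foldl (@assign R m work) e (flatten [seq filter_column r | r <- s]) c =
  match c with
  | inr (inl r) => if r \in s then e (inp r) + e (reg 0 r) else e c
  | inr (inr (inr (i, r))) =>
      if (r \in s) && (i < D)%N then
        e (reg i.+1 r) + e (coef_q i.+1) * e (inp r)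
          - e (coef_p i.+1) * (e (inp r) + e (reg 0 r))
      else e c
  | _ => e c
  end.
Proof.
elim: s e c => [|r s IH] e c; first by case: c => [?|[?|[?|[i r]]]].
rewrite cons_uniq => /andP[rs us] ct.
rewrite map_cons -[flatten (_ :: _)]/(filter_column r ++ flatten _) foldl_cat IH //.
case: c ct => [r'|[r'|[w|[i r']]]] ct; rewrite ?in_cons !filter_columnE //=.
  by case: (r' =P r) => [->|_] //=; rewrite (negPf rs).
by case: (r' =P r) => [->|_] //=; rewrite ?(negPf rs).
Qed.

Lemma filter_programE (e : cell -> R) (c : cell) :
  c != tmp ->
  foldl (@assign R m work) e filter_program c =
  match c with
  | inr (inl r) => e (inp r) + e (reg 0 r)
  | inr (inr (inr (i, r))) =>
      if (i < D)%N then
        e (reg i.+1 r) + e (coef_q i.+1) * e (inp r)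
          - e (coef_p i.+1) * (e (inp r) + e (reg 0 r))
      else e c
  | _ => e c
  end.
Proof.
move=> ct; rewrite filter_columnsE ?enum_uniq //.
by case: c ct => [?|[r|[?|[i r]]]] //= _; rewrite mem_enum.
Qed.

Definition filter_memory (P Q : {poly R}) : 'rV[R]_(m + (m + #|{: work}|)) :=
  row_mx 0 (row_mx 0 (\row_k
    match enum_val (k : 'I_#|{: work}|) : work with
    | inl (inr (inl i)) => Q`_i
    | inl (inr (inr i)) => P`_i
    | _ => 0
    end)).

Definition filter_algorithm (P Q : {poly R}) : streaming_algorithm R m :=
  StreamingAlgorithm (map (@compile m work) filter_program) (filter_memory P Q).

Lemma read_receive (z : 'rV[R]_m) (mu : 'rV[R]_(m + (m + #|{: work}|))) (c : cell) :
  read (receive z mu) c = if c is inl r then z 0 r else read mu c.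
Proof.
rewrite /read /receive; case: c => [r|[r|w]] /=; first by rewrite row_mxEl.
  by rewrite row_mxEr mxE.
by rewrite row_mxEr mxE.
Qed.

Lemma read_output (mu : 'rV[R]_(m + (m + #|{: work}|))) (r : 'I_m) :
  output mu 0 r = read mu (out r).
Proof. by rewrite /output !mxE. Qed.

Lemma space_filter_algorithm (P Q : {poly R}) :
  (space_used (filter_algorithm P Q) <= 7 * D.+1 * m + 2 * D.+2)%N.
Proof.
rewrite /space_used /= size_map size_filter_program.
rewrite !card_sum card_unit card_prod !card_ord.
nia.
Qed.

End filter.

(** Indexing by all of [nat], with 0 past the end, keeps bound proofs out of the convolutions. *)
Definition stream_entry (R : realType) (n m : nat) (Z : 'M[R]_(n, m)) (k : nat) (r : 'I_m) : R :=
  if insub k is Some i then Z i r else 0.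

Lemma toeplitz_mul_entry (R : realType) (n m : nat) (P : {poly R}) (W : 'M[R]_(n, m))
    (k : 'I_n) (r : 'I_m) :
  (toeplitz_mx n P *m W) k r = \sum_(a < k.+1) P`_a * stream_entry W (k - a) r.
Proof.
rewrite mxE (reindex_inj rev_ord_inj) /=.
pose F l := (if (l <= k)%N then P`_(k - l) else 0) * stream_entry W l r.
transitivity (\sum_(0 <= l < n) F l).
  rewrite big_mkord [in LHS](reindex_inj rev_ord_inj) /=.
  by apply: eq_bigr => l _; rewrite rev_ordK mxE /F /stream_entry valK.
rewrite (@big_cat_nat _ _ _ k.+1) ?ltn_ord //= [X in _ + X]big1_seq ?addr0; last first.
  by move=> l; rewrite mem_index_iota /F => /= /andP[kl _]; rewrite leqNgt kl mul0r.
rewrite big_mkord (reindex_inj rev_ord_inj) /=; apply: eq_bigr => a _.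
have ak : (a <= k)%N by rewrite -ltnS.
by rewrite /F subSS leq_subr subKn.
Qed.

(* Transposed direct form of the recurrence P W = Q Z: register i holds
   sum_(l < k) (Q_(i+1+l) Z_(k-1-l) - P_(i+1+l) W_(k-1-l)) after k rows. *)
Lemma filter_algorithm_streams (R : realType) (n m D t : nat) (P Q : {poly R})
    (Z W : 'M[R]_(n, m)) :
  (size P <= D.+1)%N -> (size Q <= D.+1)%N -> P`_0 = 1 -> Q`_0 = 1 ->
  (size (program (filter_algorithm m D P Q)) <= t)%N ->
  toeplitz_mx n P *m W = toeplitz_mx n Q *m Z ->
  streams_within (filter_algorithm m D P Q) t Z W.
Proof.
move=> sP sQ P0 Q0 st PW.
pose z k : 'rV[R]_m := \row_r stream_entry Z k r.
pose p := map (@compile m _) (filter_program m D).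
pose mu := fix mu k := if k is k'.+1
  then (iter t (step p) (0%N, receive (z k') (mu k'))).2
  else initial_memory (filter_algorithm m D P Q).
pose S k i r := \sum_(l < k) (Q`_(i + l).+1 * stream_entry Z (k - l.+1) r -
                              P`_(i + l).+1 * stream_entry W (k - l.+1) r).
have run k : exists mu', iter t (step p) (0%N, receive (z k) (mu k)) = (size p, mu') /\
    read mu' =1 foldl (@assign R m _) (read (receive (z k) (mu k))) (filter_program m D).
  rewrite /p size_map; apply: iter_compile.
  by move: st; rewrite /= size_map.
(* Entry (k,r) of P W = Q Z, solved for the newest output by P_0 = Q_0 = 1. *)
have rec (k : 'I_n) r : stream_entry W k r = stream_entry Z k r + S k 0%N r.
  have e : stream_entry W k r + \sum_(l < k) P`_l.+1 * stream_entry W (k - l.+1) r =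
      stream_entry Z k r + \sum_(l < k) Q`_l.+1 * stream_entry Z (k - l.+1) r.
    have := congr1 (fun A : 'M[R]_(n, m) => A k r) PW.
    by rewrite !toeplitz_mul_entry !big_ord_recl P0 Q0 !mul1r !subn0.
  by rewrite /S sumrB addrA -e addrK.
have inv k : (k <= n)%N ->
  [/\ forall i : 'I_D.+1, read (mu k) (inr (inr (inl (inr (inl i))))) = Q`_i,
      forall i : 'I_D.+1, read (mu k) (inr (inr (inl (inr (inr i))))) = P`_i &
      forall (i : 'I_D.+1) r, read (mu k) (inr (inr (inr (i, r)))) = S k i r].
  elim: k => [|k IH] kn.
    by split=> *; rewrite /read /= !row_mxEr mxE enum_rankK // /S big_ord0.
  have [IQ IP IS] := IH (ltnW kn).
  have [mu' [e1 e2]] := run k.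
  have -> : mu k.+1 = mu' by rewrite /= e1.
  split=> [i|i|i r]; rewrite e2 filter_programE // !read_receive //.
  (* The unwritten register i = D: the coefficients in its sum lie beyond the sizes of P and Q, so 0
     is the right content. *)
  case: ltnP => iD; last first.
    have coef0 (p' : {poly R}) l : (size p' <= D.+1)%N -> p'`_(i + l).+1 = 0.
      by move=> s; rewrite nth_default // (leq_trans s) // ltnS (leq_trans iD) ?leq_addr.
    by rewrite IS /S !big1 // => l _; rewrite !coef0 // !mul0r subr0.
  have i1 : (inord i.+1 : 'I_D.+1) = i.+1 :> nat by rewrite inordK.
  rewrite !IS IQ IP i1 inordK // mxE -(rec (Ordinal kn)) /=.
  (* The term l = 0 comes from the current row; the others form the old register i + 1. *)
  rewrite /S big_ord_recl addn0 subSS subn0 -addrA addrC; congr (_ + _).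
  by apply: eq_bigr => l _; rewrite /= /bump /= add1n addnS addSn subSS.
exists mu; split=> // k.
have [mu' [e1 e2]] := run k; exists (size p).
have mk : mu k.+1 = mu' by rewrite /= e1.
split=> //.
  rewrite mk -e1; congr (iter _ _ (_, receive _ _)).
  by apply/rowP => r; rewrite !mxE /stream_entry valK.
apply/rowP => r; rewrite mk read_output e2 filter_programE // !read_receive.
have [_ _ IS] := inv k (ltnW (ltn_ord k)).
rewrite IS inordK // mxE -(rec k) mxE /stream_entry valK //.
Qed.

(** * Choice of the parameters *)

(** Eighth power of exp(-1/4) >= 3/4. Base 16 makes the target error directly comparable with a
    power of 2. *)
Lemma expR2_le16 (R : realType) : expR 2 <= 16 :> R.
Proof.
have h : (3 / 4 : R) ^+ 8 <= expR (- 4^-1) ^+ 8.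
  apply: lerXn2r; rewrite ?nnegrE ?expR_ge0 //.
  by have := expR_ge1Dx (- 4^-1 : R); lra.
move: h; rewrite -expRM_natl (_ : 8 * - 4^-1 = - 2 :> R); last by field.
rewrite expRN => h.
have : 16^-1 <= (expR 2)^-1 :> R by apply: le_trans h; lra.
by rewrite lef_pV2 ?posrE ?expR_gt0.
Qed.

(** An integer stand-in for sqrt d: the lower bound on q^2 serves the error, the upper one the O(d)
    cost. *)
Lemma sqr_envelope (d : nat) : (0 < d)%N ->
  exists q : nat, [/\ (0 < q)%N, (d <= q * q)%N & (q * q <= 4 * d)%N].
Proof.
move=> d0; have ex : exists q, (d <= q * q)%N by exists d; nia.
case: (ex_minnP ex) => q dq qmin; exists q; split=> //; first by case: q dq {qmin} => [|//]; lia.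
case: q dq qmin => [|q] dq qmin //.
have : ~~ (d <= q * q)%N by apply/negP => /qmin; lia.
rewrite -ltnNge; case: q {qmin dq} => [|q]; nia.
Qed.

(** With y = (pi/2) sqrt(d-2), the hypothesis on d gives y >= 2 log n, and pi/2 < 2 gives y <= 2q;
    so n^2 <= exp(y) <= exp(2q) <= 16^q. *)
Lemma error_budget (R : realType) (n d q : nat) : (0 < n)%N ->
  2 + ((12 + 4 * ln (n%:R : R)) / pi) ^+ 2 <= d%:R -> (d <= q * q)%N ->
  let E : R := expR (- (pi / 2 * Num.sqrt (d%:R - 2))) in
  n%:R ^+ 2 <= 16 ^+ q :> R /\ 16 ^- q <= E.
Proof.
move=> n0 hd dq E.
set y := pi / 2 * Num.sqrt (d%:R - 2) in E *.
have p0 := pi_gt0 R.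
have ln0 : 0 <= ln (n%:R : R) by rewrite ln_ge0 // ler1n.
have x0 : 0 <= (12 + 4 * ln (n%:R : R)) / pi by apply: divr_ge0; [lra | exact: ltW].
have d2 : 0 <= d%:R - 2 :> R by have := sqr_ge0 ((12 + 4 * ln (n%:R : R)) / pi); lra.
have xs : (12 + 4 * ln (n%:R : R)) / pi <= Num.sqrt (d%:R - 2).
  by rewrite -[leLHS]ger0_norm // -sqrtr_sqr ler_sqrt //; lra.
have ny : n%:R ^+ 2 <= expR y.
  rewrite -[n%:R]lnK ?posrE ?ltr0n // -expRM_natl ler_expR.
  rewrite ler_pdivrMr // in xs.
  by rewrite /y mulrAC [pi * _]mulrC; lra.
have yq : y <= q%:R * 2.
  have sq : Num.sqrt (d%:R - 2) <= q%:R :> R.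
    rewrite -[q%:R]ger0_norm // -sqrtr_sqr ler_sqrt ?sqr_ge0 // expr2 -natrM.
    have : d%:R <= (q * q)%:R :> R by rewrite ler_nat.
    lra.
  rewrite /y mulrC; apply: ler_pM => //; first by rewrite divr_ge0 // ltW.
  by rewrite ltW // pihalf_lt2.
have y16 : expR y <= 16 ^+ q.
  apply: le_trans (_ : expR (q%:R * 2) <= _); first by rewrite ler_expR.
  by rewrite expRM_natl lerXn2r ?nnegrE ?expR_ge0 // expR2_le16.
split; first exact: le_trans ny y16.
by rewrite /E expRN lef_pV2 ?posrE ?expR_gt0 ?exprn_gt0.
Qed.

Theorem theorem16 (R : realType) :
  exists K : nat,
    forall n d m : nat,
      (5 <= n)%N ->
      2 + ((12 + 4 * ln (n%:R : R)) / pi) ^+ 2 <= d%:R ->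
      exists B C : 'M[R]_n,
        [/\ is_lt_toeplitz B,
            is_lt_toeplitz C,
            ones_lt R n = B *m C,
            norm_2_infty B <= norm_2_infty (toeplitz_of (@inv_sqrt_1m R) n)
              + 16 * Num.sqrt n%:R * expR (- (pi / 2 * Num.sqrt (d%:R - 2))) /\
            norm_1_2 C <= norm_1_2 (toeplitz_of (@inv_sqrt_1m R) n)
              + 16 * Num.sqrt n%:R * expR (- (pi / 2 * Num.sqrt (d%:R - 2))) &
            exists alg : streaming_algorithm R m,
              (space_used alg <= K * (d * m))%N /\
              forall Z : 'M[R]_(n, m),
                streams_within alg (K * (d * m)) Z (invmx C *m Z)].
Proof.
(* Below, D = (4q+3)(8q+3) <= 77 q^2 <= 308 d, and the space is at most (9 D + 11) m <= 2783 d m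
   when m > 0. *)
exists 3000%N => n d m n5 hd.
have n0 : (0 < n)%N by lia.
have d0 : (0 < d)%N.
  rewrite lt0n; apply/eqP => d0; move: hd; rewrite d0.
  by have := sqr_ge0 ((12 + 4 * ln (n%:R : R)) / pi); lra.
have [q [q0 dq qd]] := sqr_envelope d0.
have [nq qE] := error_budget n0 hd dq.
set E := expR _ in qE *.
(* 2^L = 8 * 16^q * 16^q: the 8 cancels the constants 4 and 2, one 16^q absorbs n^2, the other is
   the final error. As (2/3)^2 <= 1/2 and n <= 4^q, this M makes the last block short enough. *)
pose L := (8 * q + 3)%N; pose M := (4 * q + 2)%N; pose D := (M.+1 * L)%N.
have p16 : 0 < 16 ^+ q :> R by rewrite exprn_gt0.
have nM : 2 * n%:R * (2 / 3) ^+ M <= 1 :> R.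
  have n4 : n%:R <= 4 ^+ q :> R.
    rewrite -(@ler_pXn2r _ 2) ?nnegrE ?exprn_ge0 // -exprM mulnC exprM.
    by rewrite (_ : 4 ^+ 2 = 16 :> R) //; lra.
  have le1 : (2 / 3 : R) ^+ M <= (2^-1) ^+ (2 * q + 1).
    rewrite (_ : M = 2 * (2 * q + 1))%N ?exprM; last by rewrite /M; lia.
    by apply: lerXn2r; rewrite ?nnegrE; lra.
  apply: le_trans (_ : 2 * 4 ^+ q * (2^-1) ^+ (2 * q + 1) <= _).
    by apply: ler_pM; rewrite ?mulr_ge0 ?exprn_ge0 ?ler_pM2l //; lra.
  rewrite exprD exprM expr1 (_ : 2^-1 ^+ 2 = 4^-1 :> R); last by field.
  rewrite exprVn (_ : _ * (_ / _) = 1) //.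
  by field; rewrite expf_neq0.
have L0 : (0 < L)%N by rewrite /L addn3.
have [c [P [Q [QcP c0 Q0 [sP sQ] ce]]]] := rational_approximation n0 L0 nM.
have small : 4 * n%:R ^+ 2 * (2 / 2 ^+ L) <= 16 ^- q :> R.
  have -> : 2 ^+ L = 16 ^+ q * 16 ^+ q * 8 :> R.
    by rewrite /L exprD exprM -exprMn; congr (_ ^+ _ * _); lra.
  rewrite (_ : _ * _ = n%:R ^+ 2 / 16 ^+ q * 16 ^- q); last by field; rewrite gt_eqF.
  by rewrite ler_piMl ?invr_ge0 ?(ltW p16) // ler_pdivrMr // mul1r.
have E0 : 0 <= E by exact: expR_ge0.
have q1 : 16 ^- q <= 1 :> R by rewrite invf_le1 // exprn_ege1 // ler1n.
have [b [u [bc uc be]]] := cofactor_perturbation c0 ce (le_trans small q1).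
(* C deviates by 2/2^L only, so the weaker bound for B serves both. *)
have eps_le : 2 / 2 ^+ L <= 4 * n%:R ^+ 2 * (2 / 2 ^+ L) :> R.
  rewrite ler_peMl ?divr_ge0 ?exprn_ge0 //.
  have : 1 <= n%:R ^+ 2 :> R by rewrite exprn_ege1 // ler1n.
  by lra.
have leE x : x <= 4 * n%:R ^+ 2 * (2 / 2 ^+ L) -> x <= 16 * E.
  by move=> h; have := le_trans (le_trans h small) qE; lra.
have E16 : 16 * Num.sqrt n%:R * E = Num.sqrt n%:R * (16 * E) by ring.
have close (p : {poly R}) : (forall k, (k < n)%N -> `|p`_k - central R k| <= 16 * E) ->
    forall i j, `|toeplitz_mx n p i j - toeplitz_of (@inv_sqrt_1m R) n i j| <= 16 * E.
  move=> pE i j; rewrite !mxE taylor_inv_sqrt.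
  case: leqP => ij; last by rewrite subrr normr0 mulr_ge0.
  by apply: pE; have := ltn_ord i; lia.
pose C := toeplitz_mx n c.
have [_ Cu] : toeplitz_mx n u \in unitmx /\ C \in unitmx.
  by apply: mulmx1_unit; rewrite -toeplitz_mxM (eq_toeplitz_mx uc) toeplitz_mx1.
exists (toeplitz_mx n b), C; split.
- exact: toeplitz_mxP.
- exact: toeplitz_mxP.
- by rewrite ones_ltE -toeplitz_mxM (eq_toeplitz_mx bc).
- rewrite E16; split.
    apply: norm_2_infty_perturbation; first by rewrite mulr_ge0.
    by apply: close => k kn; apply/leE/be.
  rewrite !norm_1_2_tr; apply: norm_2_infty_perturbation; first by rewrite mulr_ge0.
  move=> i j; rewrite [C^T _ _]mxE [(toeplitz_of _ _)^T _ _]mxE.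
  by apply: close => k kn; apply/leE/(le_trans (ce k kn)).
(* At m = 0 the budget is 0, which leaves no room for the coefficient and scratch cells; the empty
   program with no memory serves. *)
case: m => [|m].
  exists (@StreamingAlgorithm R 0 0 [::] 0); split=> // Z.
  exists (fun=> 0); split=> // k; exists 0%N; split=> //.
    by rewrite !muln0 /=; congr (_, _); apply/rowP => -[].
  by apply/rowP => -[].
have size_le : (space_used (filter_algorithm m.+1 D P Q) <= 3000 * (d * m.+1))%N.
  apply: leq_trans (space_filter_algorithm _ _ _ _) _.
  apply: (@leq_trans ((9 * D + 11) * m.+1)); first by nia.
  rewrite mulnA leq_mul2r /= /D /M /L.
  by nia.
exists (filter_algorithm m.+1 D P Q); split=> // Z.
apply: filter_algorithm_streams => //.
- by rewrite -(QcP 0%N n0) coefM big_ord1 Q0 c0 mulr1.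
(* The program is straight-line, so its running time is its length, already charged as space. *)
- exact: leq_trans (leq_addl _ _) size_le.
(* Since P = Q c modulo x^n, applying P to C^-1 Z gives Q Z. *)
- by rewrite mulmxA -(eq_toeplitz_mx QcP) toeplitz_mxM -[toeplitz_mx n c]/C mulmxK.
Qed.
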